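(* Let $X$ be a (real or complex) Banach space, let $d\in\mathbb{N}$, and let $\alpha,\beta$ be reasonable cross norms on $\otimes^d X$. Let $\mathbb{V}^d_X=\{x\otimes\stackrel{d}{\cdots}\otimes x:\ x\in X\}\subset\otimes^d X$. Then: (i) The metric spaces $(\mathbb{V}^d_X,d_\alpha)$ and $(\mathbb{V}^d_X,d_\beta)$ are bi-Lipschitz equivalent through the identity mapping, and for every $w,z\in\mathbb{V}^d_X$ one has $d_\alpha(w,z)\le 2^{d-1}d_\beta(w,z)$. (ii) $(\mathbb{V}^d_X,d_\alpha)$ is a complete metric space.
   Context: $\otimes^d X$ denotes the algebraic $d$-fold tensor product $X\otimes\stackrel{d}{\cdots}\otimes X$. A norm $\alpha$ on $\otimes^d X$ is a reasonable cross norm if (a) $\alpha(x_1\otimes\cdots\otimes x_d)\le\|x_1\|\cdots\|x_d\|$ for all $x_1,\dots,x_d\in X$, and (b) for all $x_1^*,\dots,x_d^*\in X^*$ the linear functional $x_1^*\otimes\cdots\otimes x_d^*$ is bounded for $\alpha$, with norm at most $\|x_1^*\|\cdots\|x_d^*\|$. $d_\alpha$ denotes the distance induced by the norm $\alpha$, i.e. $d_\alpha(w,z)=\alpha(w-z)$. *)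

(* Defs.v *)
From HB Require Import structures.
From mathcomp Require Import all_boot all_order all_algebra generic_quotient.
From mathcomp Require Import all_classical all_reals all_analysis.
From mathcomp.real_closed Require Import complex.

Set Implicit Arguments.
Unset Strict Implicit.
Unset Printing Implicit Defensive.

Import Order.TTheory GRing.Theory Num.Theory.
Import numFieldNormedType.Exports.

Local Open Scope classical_set_scope.
Local Open Scope ring_scope.
Local Open Scope quotient_scope.

(* Norms in the library take their values in the scalar field. In [R[i]] the
   order is partial, [0 <= z] meaning that [z] is real and nonnegative, so that
   norms, distances, radii and Lipschitz constants are real in both cases. *)
Inductive real_or_complex (R : realType) : numFieldType -> Prop :=
| RealScalars : real_or_complex R (R : numFieldType)
| ComplexScalars : real_or_complex R (R[i] : numFieldType).

Definition upd (I : eqType) (T : Type) (x : I -> T) (i : I) (u : T) : I -> T :=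
  fun j => if j == i then u else x j.

Definition multilinear (K : numFieldType) (X W : lmodType K) (d : nat)
    (f : ('I_d -> X) -> W) : Prop :=
  forall (x : 'I_d -> X) (i : 'I_d) (a : K) (u v : X),
    f (upd x i (a *: u + v)) = a *: f (upd x i u) + f (upd x i v).

(* The algebraic tensor power is the space of formal sums of
   [a (x_1, ..., x_d)], two of them being identified when every multilinear map,
   into any vector space, takes the same value on both. The lemmas
   [tens_multilinear], [tlift_tens] and [tlift_unique] give the universal
   property. *)
Section TensorPower.
Context (K : numFieldType) (X : lmodType K) (d : nat).

Definition formal_sum := {classic (seq (K * ('I_d -> X)))}.

Definition fs_eval (W : lmodType K) (f : ('I_d -> X) -> W)
    (s : formal_sum) : W := \sum_(p <- (s : seq _)) p.1 *: f p.2.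

Definition fs_eq (s t : formal_sum) : Prop :=
  forall (W : lmodType K) (f : ('I_d -> X) -> W),
    multilinear f -> fs_eval f s = fs_eval f t.

Definition fs_eqb : rel formal_sum := fun s t => `[< fs_eq s t >].

Lemma fs_eqb_equiv : equiv_class_of fs_eqb.
Proof.
split=> [s|s t|t s u].
- exact/asboolP.
- by apply/asboolP/asboolP => st W f mf; rewrite st.
- by move=> /asboolP st /asboolP tu; apply/asboolP => W f mf; rewrite st// tu.
Qed.

Canonical fs_equiv := EquivRelPack fs_eqb_equiv.

Definition tpow := {eq_quot fs_equiv}.

HB.instance Definition _ := Choice.on tpow.
HB.instance Definition _ := EqQuotient.on tpow.

Definition teval (W : lmodType K) (f : ('I_d -> X) -> W) (w : tpow) : W :=
  fs_eval f (repr w).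

Lemma teval_pi (W : lmodType K) (f : ('I_d -> X) -> W) (s : formal_sum) :
  multilinear f -> teval f (\pi_tpow s) = fs_eval f s.
Proof.
move=> mf; rewrite /teval.
by have /eqmodP/asboolP -> : repr (\pi_tpow s) = s %[mod tpow] by rewrite reprK.
Qed.

Lemma tpow_ext (w z : tpow) :
  (forall (W : lmodType K) (f : ('I_d -> X) -> W),
    multilinear f -> teval f w = teval f z) -> w = z.
Proof.
move=> wz; rewrite -[w]reprK -[z]reprK; apply/eqmodP/asboolP => W f mf.
exact: wz.
Qed.

Definition tzero : tpow := \pi_tpow ([::] : seq (K * ('I_d -> X))).
Definition tadd (w z : tpow) : tpow :=
  \pi_tpow ((repr w : seq (K * ('I_d -> X))) ++ repr z).
Definition tscale (a : K) (w : tpow) : tpow :=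
  \pi_tpow [seq (a * p.1, p.2) | p <- (repr w : seq (K * ('I_d -> X)))].
Definition topp (w : tpow) : tpow := tscale (-1) w.

Section teval.
Context (W : lmodType K) (f : ('I_d -> X) -> W) (mf : multilinear f).

Lemma teval0 : teval f tzero = 0.
Proof. by rewrite teval_pi// /fs_eval big_nil. Qed.

Lemma tevalD w z : teval f (tadd w z) = teval f w + teval f z.
Proof. by rewrite teval_pi// /fs_eval big_cat. Qed.

Lemma tevalZ a w : teval f (tscale a w) = a *: teval f w.
Proof.
rewrite teval_pi// /teval /fs_eval big_map scaler_sumr.
by apply: eq_bigr => p _; rewrite scalerA.
Qed.

Lemma tevalN w : teval f (topp w) = - teval f w.
Proof. by rewrite tevalZ scaleN1r. Qed.

End teval.

Let tevalE := (teval0, tevalD, tevalZ, tevalN).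

Lemma taddA : associative tadd.
Proof. by move=> u v w; apply: tpow_ext => W f mf; rewrite !tevalE// addrA. Qed.

Lemma taddC : commutative tadd.
Proof. by move=> u v; apply: tpow_ext => W f mf; rewrite !tevalE// addrC. Qed.

Lemma tadd0 : left_id tzero tadd.
Proof. by move=> u; apply: tpow_ext => W f mf; rewrite !tevalE// add0r. Qed.

Lemma taddN : left_inverse tzero topp tadd.
Proof. by move=> u; apply: tpow_ext => W f mf; rewrite !tevalE// addNr. Qed.

HB.instance Definition _ := GRing.isZmodule.Build tpow taddA taddC tadd0 taddN.

Lemma tscaleA a b w : tscale a (tscale b w) = tscale (a * b) w.
Proof. by apply: tpow_ext => W f mf; rewrite !tevalE// scalerA. Qed.

Lemma tscale1 : left_id 1 tscale.
Proof. by move=> u; apply: tpow_ext => W f mf; rewrite !tevalE// scale1r. Qed.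

Lemma tscaleDr : right_distributive tscale +%R.
Proof.
by move=> a u v; apply: tpow_ext => W f mf; rewrite !tevalE// scalerDr.
Qed.

Lemma tscaleDl v : {morph tscale^~ v : a b / a + b}.
Proof.
by move=> a b; apply: tpow_ext => W f mf; rewrite !tevalE// scalerDl.
Qed.

HB.instance Definition _ :=
  GRing.Zmodule_isLmodule.Build K tpow tscaleA tscale1 tscaleDr tscaleDl.

Definition tens (x : 'I_d -> X) : tpow :=
  \pi_tpow ([:: (1, x)] : seq (K * ('I_d -> X))).

Lemma teval_tens (W : lmodType K) (f : ('I_d -> X) -> W) x :
  multilinear f -> teval f (tens x) = f x.
Proof. by move=> mf; rewrite teval_pi// /fs_eval big_seq1 scale1r. Qed.

Lemma tens_multilinear : multilinear tens.
Proof.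
move=> x i a u v; apply: tpow_ext => W f mf.
by rewrite (tevalD mf) (tevalZ mf) !teval_tens.
Qed.

Lemma teval_linear (W : lmodType K) (f : ('I_d -> X) -> W) :
  multilinear f -> linear (teval f).
Proof. by move=> mf a w z; rewrite (tevalD mf) (tevalZ mf). Qed.

Definition tlift (W : lmodType K) (f : ('I_d -> X) -> W)
    (mf : multilinear f) : {linear tpow -> W} :=
  HB.pack (teval f) (GRing.isLinear.Build K tpow W *:%R _ (teval_linear mf)).

Lemma tlift_tens (W : lmodType K) (f : ('I_d -> X) -> W)
  (mf : multilinear f) x : tlift mf (tens x) = f x.
Proof. exact: teval_tens. Qed.

Lemma tens_span (w : tpow) : exists s : seq (K * ('I_d -> X)),
  w = \sum_(p <- s) p.1 *: tens p.2.
Proof.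
exists (repr w); apply: tpow_ext => W f mf; rewrite [in LHS]/teval.
have -> : teval f = tlift mf by [].
rewrite linear_sum; apply: eq_bigr => p _.
by rewrite linearZ /= teval_tens.
Qed.

Lemma tlift_unique (W : lmodType K) (g h : {linear tpow -> W}) :
  (forall x, g (tens x) = h (tens x)) -> g =1 h.
Proof.
move=> gh w; have [s ->] := tens_span w.
by rewrite !linear_sum; apply: eq_bigr => p _; rewrite !linearZ /= gh.
Qed.

Lemma prod_multilinear (phi : 'I_d -> {linear X -> K^o}) :
  multilinear (fun x => \prod_i phi i (x i) : K^o).
Proof.
move=> x i a u v.
have E y : \prod_j phi j (upd x i y j) =
    phi i y * \prod_(j < d | j != i) phi j (x j) :> K.
  rewrite (bigD1 i)//= /upd eqxx; congr (_ * _).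
  by apply: eq_bigr => j /negPf ->.
by rewrite !E linearP /= mulrDl -mulrA.
Qed.

(* [phi_1 (x) ... (x) phi_d] *)
Definition tfun (phi : 'I_d -> {linear X -> K^o}) : {linear tpow -> K^o} :=
  tlift (prod_multilinear phi).

Definition veronese : set tpow := [set w | exists x : X, w = tens (fun=> x)].

End TensorPower.

Arguments veronese {K} X d.

Section Norms.
Context (K : numFieldType).

Record is_norm (V : lmodType K) (N : V -> K) : Prop := IsNorm {
  is_norm_ge0 : forall w, 0 <= N w;
  is_norm_eq0 : forall w, N w = 0 -> w = 0;
  is_normZ : forall (a : K) w, N (a *: w) = `|a| * N w;
  is_normD : forall w z, N (w + z) <= N w + N z }.

Definition bounded_for (V : lmodType K) (N : V -> K) (phi : V -> K) : Prop :=
  exists M : K, forall w, `|phi w| <= M * N w.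

(* The norm of a functional [phi] that is bounded for [N]; it is not
   meaningful when [phi] is unbounded. *)
Definition dual_norm (V : lmodType K) (N : V -> K) (phi : V -> K) : K :=
  supremum 0 [set `|phi w| | w in [set w | N w <= 1]].

Record reasonable_cross_norm (X : normedModType K) (d : nat)
    (alpha : tpow X d -> K) : Prop := ReasonableCrossNorm {
  rcn_norm : is_norm alpha;
  rcn_tens : forall x : 'I_d -> X, alpha (tens x) <= \prod_i `|x i|;
  rcn_dual : forall phi : 'I_d -> {linear X -> K^o},
    (forall i, continuous (phi i)) ->
    bounded_for alpha (tfun phi) /\
    dual_norm alpha (tfun phi) <=
      \prod_i dual_norm (fun x : X => `|x|) (phi i) }.

Definition norm_dist (V : zmodType) (N : V -> K) (w z : V) : K := N (w - z).

(* In what follows a metric space is a subset [A] of a type [T] together with a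
   distance on [A] that is given as a function on all of [T]. *)
Definition metric_on (T : Type) (A : set T) (dist : T -> T -> K) : Prop :=
  [/\ forall x y, A x -> A y -> 0 <= dist x y,
      forall x y, A x -> A y -> (dist x y = 0 <-> x = y),
      forall x y, A x -> A y -> dist x y = dist y x
    & forall x y z, A x -> A y -> A z -> dist x z <= dist x y + dist y z].

Definition bi_lipschitz (S T : Type) (A : set S) (B : set T)
    (distA : S -> S -> K) (distB : T -> T -> K) (f : S -> T) : Prop :=
  [/\ metric_on A distA, metric_on B distB, set_bij A B f
    & exists L M : K, [/\ 0 < L, 0 < M &
      forall x y, A x -> A y ->
        distB (f x) (f y) <= L * distA x y /\
        distA x y <= M * distB (f x) (f y)]].

Definition cauchy_seq (T : Type) (dist : T -> T -> K) (u : nat -> T) : Prop :=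
  forall e : K, 0 < e -> exists N : nat, forall m n : nat,
    (N <= m)%N -> (N <= n)%N -> dist (u m) (u n) < e.

Definition cvg_seq (T : Type) (dist : T -> T -> K) (u : nat -> T) (l : T) :
    Prop :=
  forall e : K, 0 < e -> exists N : nat, forall n : nat,
    (N <= n)%N -> dist (u n) l < e.

Definition complete_metric (T : Type) (A : set T) (dist : T -> T -> K) : Prop :=
  metric_on A dist /\
  forall u : nat -> T, (forall n, A (u n)) -> cauchy_seq dist u ->
    exists2 l, A l & cvg_seq dist u l.

End Norms.

(* Main.v *)
(** A reasonable cross norm dominates the values of all functionals
    [phi_1 (x) ... (x) phi_d] with [phi_i] in the dual ball, and is at most
    [|x_1| ... |x_d|] on elementary tensors.

    Given [x], [y] and [c > 1], let [phi], [psi] almost maximise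
    [|phi x * psi y - psi x * phi y|] over the dual ball. Cramer's rule gives
    [e_1], [e_2] of norm at most [c] such that [v = phi v *: e_1 + psi v *: e_2]
    for [v = x, y]. Expanding all slots but the last of [x^d - y^d] on
    [e_1, e_2] yields [2 ^ (d - 1)] elementary tensors, and the norm of the
    vector in the last slot of each one is attained at a contraction, hence is a
    value at [x^d - y^d] of a product of contractions. Then [c] tends to [1].

    For completeness, let [x_m^d] be Cauchy and not null, and let [phi] be
    norming for a late [x_N]. Testing against [phi^(d - 1) (x) psi] shows that
    [z_m = phi(x_m)^(d - 1) *: x_m] is Cauchy in [X]; if [z_m] tends to [z]
    then [x_m^d] tends to [(phi z)^(1 - d) *: z^d]. The scalar is a [d]-th power
    because [phi z / phi(x_N)^d] is close to [1]. *)

Require Import Defs.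
From HB Require Import structures.
From mathcomp Require Import all_boot all_order all_algebra.
From mathcomp Require Import all_classical all_reals all_analysis.
From mathcomp.real_closed Require Import complex.
From mathcomp Require Import ring lra.

Set Implicit Arguments.
Unset Strict Implicit.
Unset Printing Implicit Defensive.

Import Order.TTheory GRing.Theory Num.Theory.
Import numFieldNormedType.Exports.
Local Open Scope classical_set_scope.
Local Open Scope ring_scope.

(** * Hahn-Banach for sublinear functionals on a real space *)

Section HahnBanach.
Context (R : realType) (V : lmodType R).
Implicit Types (p q : V -> R) (x y u : V).

Definition sublinear q :=
  (forall x y, q (x + y) <= q x + q y) /\
  (forall (t : R) x, 0 <= t -> q (t *: x) <= t * q x).

Lemma sublinear0 q : sublinear q -> q 0 = 0.
Proof.
move=> [qD qZ]; apply/eqP; rewrite eq_le.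
have := qZ 0 0 (lexx _); rewrite scaler0 mul0r => -> /=.
by have := qD 0 0; rewrite addr0; move=> *; lra.
Qed.

Lemma sublinearZ q (t : R) x : sublinear q -> 0 <= t -> q (t *: x) = t * q x.
Proof.
move=> sq; rewrite le_eqVlt => /predU1P[<-|t0].
  by rewrite scale0r mul0r (sublinear0 sq).
have [_ qZ] := sq; apply/eqP; rewrite eq_le qZ/= ?(ltW t0)//.
have := qZ t^-1 (t *: x); rewrite scalerA mulVf ?gt_eqF// scale1r invr_ge0.
by move/(_ (ltW t0)); rewrite ler_pdivlMl.
Qed.

Lemma sublinear_geN q x : sublinear q -> - q (- x) <= q x.
Proof.
move=> sq; have := sq.1 x (- x); rewrite subrr (sublinear0 sq); move=> *; lra.
Qed.

Let shift q y x := [set q (x + t *: y) - t * q y | t in [set t : R | 0 <= t]].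

(** For sublinear [q], taking [t = 0] and [t = 1] shows that this lies below [q] and is at most
    [- q y] at [- y]; a linear functional below it therefore takes the value [q y] at [y]. *)
Definition sublinear_shift q y x := inf (shift q y x).

Section shift.
Context (q : V -> R) (y : V) (sq : sublinear q).

Lemma has_inf_shift x : has_inf (shift q y x).
Proof.
split; first by exists (q (x + 0 *: y) - 0 * q y), 0 => //=.
exists (- q (- x)) => _ [t /= t0 <-].
have := sq.1 (x + t *: y) (- x).
rewrite addrAC subrr add0r sublinearZ//; move=> *; lra.
Qed.

Lemma sublinear_shift_le (t : R) x : 0 <= t ->
  sublinear_shift q y x <= q (x + t *: y) - t * q y.
Proof.
by move=> t0; apply: ge_inf; [exact: (has_inf_shift x).2|exists t].
Qed.

Lemma le_sublinear_shift b x :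
  (forall t : R, 0 <= t -> b <= q (x + t *: y) - t * q y) ->
  b <= sublinear_shift q y x.
Proof.
move=> bq; apply: lb_le_inf; first exact: (has_inf_shift x).1.
by move=> _ [t t0 <-]; exact: bq.
Qed.

Lemma sublinear_sublinear_shift : sublinear (sublinear_shift q y).
Proof.
split=> [x1 x2|s x s0].
- rewrite -lerBlDr; apply: le_sublinear_shift => t1 t10.
  rewrite lerBlDr -lerBlDl; apply: le_sublinear_shift => t2 t20.
  have := sublinear_shift_le (x1 + x2) (addr_ge0 t10 t20).
  rewrite scalerDl (addrACA x1) mulrDl.
  have := sq.1 (x1 + t1 *: y) (x2 + t2 *: y); move=> *; lra.
- move: s0; rewrite le_eqVlt => /predU1P[<-|s0].
    rewrite scale0r mul0r; have := sublinear_shift_le 0 (lexx 0).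
    by rewrite scale0r addr0 (sublinear0 sq) mul0r subr0.
  rewrite -ler_pdivrMl//; apply: le_sublinear_shift => t t0.
  rewrite ler_pdivrMl//.
  have := sublinear_shift_le (s *: x) (mulr_ge0 (ltW s0) t0).
  by rewrite -scalerA -scalerDr (sublinearZ _ sq (ltW s0)) -mulrA -mulrBr.
Qed.

End shift.

(** Zorn's lemma for the reversed pointwise order. The infimum over a chain stays subadditive
    because the smaller of two members can be used at both points. *)
Lemma sublinear_min p : sublinear p -> exists2 q, sublinear q &
  (forall x, q x <= p x) /\
  (forall r, sublinear r -> (forall x, r x <= q x) -> forall x, q x <= r x).
Proof.
move=> sp.
pose T := {q | sublinear q /\ forall x, q x <= p x}.
pose le (s t : T) := `[< forall x, sval t x <= sval s x >].
have tp : T by exists p.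
have [||A tot|[q [sq qp]] qmin] := @ZL_preorder T tp le.
- by move=> t; exact/asboolP.
- move=> r s t /asboolP rs /asboolP st; apply/asboolP => x.
  exact: le_trans (st x) (rs x).
(* The empty chain is bounded by [p] itself. *)
- have [[t0 At0]|A0] := pselect (A !=set0); last first.
    by exists tp => s As; exfalso; apply: A0; exists s.
  pose S x := [set sval t x | t in A].
  have hS x : has_inf (S x).
    split; first by exists (sval t0 x), t0.
    exists (- p (- x)) => _ [[q [sq qp]] _ <-] /=.
    by apply: le_trans (sublinear_geN x sq); rewrite lerN2.
  have infle t x : A t -> inf (S x) <= sval t x.
    by move=> At; apply: ge_inf; [exact: (hS x).2|exists t].
  have sm : sublinear (fun x => inf (S x)).
    split=> [x y|t x t0'].
    - rewrite -lerBlDr.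
      apply: lb_le_inf => [|_ [q1 Aq1 <-]]; first exact: (hS x).1.
      rewrite lerBlDl -lerBlDr.
      apply: lb_le_inf => [|_ [q2 Aq2 <-]]; first exact: (hS y).1.
      rewrite lerBlDl.
      have [/asboolP q12|/asboolP q21] := tot _ _ Aq1 Aq2.
      + apply: le_trans (infle _ _ Aq2) _; have := (svalP q2).1.1 x y.
        by have := q12 x; move=> *; lra.
      + apply: le_trans (infle _ _ Aq1) _; have := (svalP q1).1.1 x y.
        by have := q21 y; move=> *; lra.
    - move: t0'; rewrite le_eqVlt => /predU1P[<-|t0'].
        rewrite scale0r mul0r; apply: le_trans (infle _ _ At0) _.
        by rewrite (sublinear0 (svalP t0).1).
      rewrite -ler_pdivrMl//.
      apply: lb_le_inf => [|_ [q Aq <-]]; first exact: (hS x).1.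
      rewrite ler_pdivrMl//; apply: le_trans (infle _ _ Aq) _.
      by apply: (svalP q).1.2; exact: ltW.
  have mp x : inf (S x) <= p x.
    by apply: le_trans (infle _ _ At0) _; exact: (svalP t0).2.
  exists (exist _ (fun x => inf (S x)) (conj sm mp)) => s As.
  by apply/asboolP => x; exact: infle.
- exists q => //; split=> // r sr rq.
  have rp x : r x <= p x by exact: le_trans (rq x) (qp x).
  by have /(_ (asboolT rq))/asboolP := qmin (exist _ r (conj sr rp)).
Qed.

(* A minimal sublinear functional [q] is linear, since [sublinear_shift q y] is
   sublinear, below [q], and its value at [x] is at most [q (x + y) - q y]. *)
Lemma Hahn_Banach p u : sublinear p -> exists f : V -> R,
  [/\ linear_for *%R f, forall x, f x <= p x & p u <= f u].
Proof.
move=> sp; have ssp := sublinear_sublinear_shift u sp.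
have [q sq [qp qmin]] := sublinear_min ssp.
have qD x y : q (x + y) = q x + q y.
  apply/eqP; rewrite eq_le sq.1/=.
  have := qmin _ (sublinear_sublinear_shift y sq).
  have le_q z : sublinear_shift q y z <= q z.
    apply: le_trans (sublinear_shift_le y sq z (lexx _)) _.
    by rewrite scale0r addr0 mul0r subr0.
  move=> /(_ le_q x) /le_trans/(_ (sublinear_shift_le y sq x ler01)).
  by rewrite scale1r mul1r; move=> *; lra.
have qN x : q (- x) = - q x.
  by have := qD x (- x); rewrite subrr (sublinear0 sq); move=> *; lra.
exists q; split.
- move=> a x y; rewrite qD; congr (_ + _).
  have [a0|/ltW a0] := leP 0 a; first by rewrite (sublinearZ x sq a0).
  rewrite -[a *: x]opprK -scaleNr qN (sublinearZ x sq) ?oppr_ge0//.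
  by rewrite -mulNr opprK.
- move=> x; apply: le_trans (qp x) _.
  apply: le_trans (sublinear_shift_le u sp x (lexx _)) _.
  by rewrite scale0r addr0 mul0r subr0.
- rewrite -[q u]opprK -qN lerNr; apply: le_trans (qp _) _.
  apply: le_trans (sublinear_shift_le u sp _ ler01) _.
  by rewrite scale1r addNr (sublinear0 sp) mul1r sub0r.
Qed.

End HahnBanach.

(** * Norming functionals over real and complex scalars *)

Section RestrictScalars.
Context (R : realType).

(** An alias that can carry a real module structure beside the complex one of [V]. *)
Definition restrict_scalars (V : lmodType R[i]) : Type := V.
Context (V : lmodType R[i]).
HB.instance Definition _ := GRing.Zmodule.on (restrict_scalars V).

Let rscale (r : R) (x : restrict_scalars V) : restrict_scalars V :=
  (r%:C)%C *: (x : V).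

Let rscaleA a b x : rscale a (rscale b x) = rscale (a * b) x.
Proof. by rewrite /rscale scalerA -rmorphM. Qed.

Let rscale1 : left_id 1 rscale.
Proof. by move=> x; rewrite /rscale rmorph1 scale1r. Qed.

Let rscaleDr : right_distributive rscale +%R.
Proof. by move=> a x y; exact: (scalerDr _ (x : V)). Qed.

Let rscaleDl x : {morph rscale^~ x : a b / a + b}.
Proof. by move=> a b; rewrite /rscale rmorphD; exact: (scalerDl (x : V)). Qed.

HB.instance Definition _ := GRing.Zmodule_isLmodule.Build R (restrict_scalars V)
  rscaleA rscale1 rscaleDr rscaleDl.

Lemma restrict_scalarsZ (r : R) (x : V) :
  r *: (x : restrict_scalars V) = (r%:C)%C *: x.
Proof. by []. Qed.

End RestrictScalars.

(** Hahn-Banach is applied to the norm as a sublinear functional, in the complex case on the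
    underlying real space. *)
Lemma norming_functional (R : realType) (K : numFieldType)
    (hK : real_or_complex R K) (X : normedModType K) (u : X) :
  exists f : {linear X -> K^o},
    (forall x, `|f x| <= `|x|) /\ `|u| <= `|f u|.
Proof.
case: K / hK X u => X u.
- have sp : sublinear (fun x : X => `|x|).
    split=> [x y|t x t0]; first exact: ler_normD.
    by rewrite normrZ ger0_norm.
  have [f [lf fp pf]] := Hahn_Banach u sp.
  pose F : {linear X -> R^o} :=
    HB.pack f (GRing.isLinear.Build R X R^o *:%R f lf).
  exists F; split=> [x|]; last exact: le_trans pf (ler_norm _).
  rewrite ler_norml fp andbT lerNl.
  by have := fp (- x); rewrite normrN -[f (- x)]/(F (- x)) linearN.
- pose p (x : restrict_scalars X) : R := complex.Re `|x : X|.
  have pE (x : X) : (p x)%:C%C = `|x| by rewrite /p RRe_real// normr_real.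
  have sp : sublinear p.
    split=> [x y|t x t0].
      by rewrite -lecR rmorphD/= !pE; exact: ler_normD.
    rewrite -lecR rmorphM/= !pE restrict_scalarsZ normrZ ger0_norm//.
    by rewrite ler0c.
  have [f [lf fp pf]] := Hahn_Banach (u : restrict_scalars X) sp.
  have fD (x y : X) : f (x + y) = f x + f y.
    by have := lf 1 x y; rewrite scale1r mul1r.
  have f0 : f 0 = 0 by have := fD 0 0; rewrite addr0 => h; lra.
  have fZ (r : R) (x : X) : f ((r%:C)%C *: x) = r * f x.
    by have := lf r x 0; rewrite addr0 f0 addr0.
  (* The complex-linear functional with real part [f]. *)
  pose eta (x : X) : R[i]^o := (f x +i* - f ('i *: x))%C.
  have ceta (c : R[i]) (x : X) : eta (c *: x) = c * eta x.
    have fc (a b : R) (y : X) :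
        f ((a +i* b)%C *: y) = a * f y + b * f ('i%C *: y).
      rewrite -!fZ -fD scalerA -scalerDl; congr (f (_ *: y)).
      by rewrite [LHS]complexE/= [in RHS]mulrC.
    case: c => a b; rewrite /eta scalerA.
    have -> : ('i * (a +i* b))%C = (- b +i* a)%C :> R[i].
      by simpc.
    rewrite (fc a b) (fc (- b) a); apply/eqP; rewrite eq_complex /=.
    by apply/andP; split; apply/eqP; ring.
  have leta : linear eta.
    move=> c x y; rewrite -[c *: eta x]/(c * eta x) -ceta /eta scalerDr !fD.
    by apply/eqP; rewrite eq_complex /= opprD !eqxx.
  pose F : {linear X -> R[i]^o} :=
    HB.pack eta (GRing.isLinear.Build R[i] X R[i]^o *:%R eta leta).
  exists F; split=> [x|].
  + have [->|z0] := eqVneq (F x) 0; first by rewrite normr0.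
    (* Rotating [x] by the unimodular [c] turns the value of [F] into the real number [|F x|], which
       is then a value of [f]. *)
    pose c : R[i] := `|F x| / F x.
    have c1 : `|c| = 1 by rewrite normrM normfV normr_id divff// normr_eq0.
    have := fp (c *: x); rewrite -lecR pE normrZ c1 mul1r.
    have -> : f (c *: x) = complex.Re (eta (c *: x)) by [].
    by rewrite ceta [c * _]divfK// RRe_real// normr_real.
  + rewrite -pE; apply: le_trans (normc_ge_Re _); rewrite lecR.
    exact: le_trans pf (ler_norm _).
Qed.

(** * Suprema, roots and limiting inequalities for scalars *)

(** Nonnegative elements of [R[i]] are real, and so are the upper bounds of a nonempty set of them;
    the supremum of the real parts serves. *)
Lemma exists_supremum (R : realType) (K : numFieldType)
    (hK : real_or_complex R K) (A : set K) (M : K) :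
  A !=set0 -> (forall x, A x -> 0 <= x) -> ubound A M ->
  exists s, supremums A s.
Proof.
case: K / hK A M => A M A0 Age0 AM.
- have hA : has_sup A by split=> //; exists M.
  exists (sup A); split; first exact: sup_upper_bound.
  by move=> b /ge_sup; exact.
- have [x0 Ax0] := A0.
  pose B := [set complex.Re x | x in A].
  have hB : has_sup B.
    split; first by exists (complex.Re x0), x0.
    exists (complex.Re M) => _ [x Ax <-].
    by have := AM _ Ax; rewrite lecE => /andP[].
  exists (sup B)%:C%C; split=> [x Ax|b bA].
  + rewrite -[x]RRe_real ?ger0_real ?Age0// lecR.
    by apply: sup_upper_bound => //; exists x.
  + have b0 : 0 <= b by exact: le_trans (Age0 _ Ax0) (bA _ Ax0).
    rewrite -[b]RRe_real ?ger0_real// lecR; apply: ge_sup; first exact: hB.1.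
    by move=> _ [x Ax <-]; have := bA _ Ax; rewrite lecE => /andP[].
Qed.

(** A real [b] this close to 1 is nonnegative, so a real power is a root; the complex numbers are
    algebraically closed. *)
Lemma exists_root_near1 (R : realType) (K : numFieldType)
    (hK : real_or_complex R K) (n : nat) (b : K) :
  `|b - 1| < 1 -> exists r, r ^+ n.+1 = b.
Proof.
case: K / hK b => b b1; last by exists (n.+1.-root b); rewrite rootCK.
have b0 : 0 <= b by move: b1; rewrite ltr_norml => /andP[]; lra.
exists (b `^ n.+1%:R^-1); rewrite -powR_mulrn ?powR_ge0//.
by rewrite -powRrM mulVf ?pnatr_eq0// powRr1.
Qed.

(** The limit [c -> 1], one factor at a time: the hypothesis at the smaller of [c] and [c'] gives
    [A <= c' ^+ n * (c * B)]. *)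
Lemma le_of_forall_gt1_expr (K : numFieldType) (A B : K) (n : nat) :
  0 <= A -> 0 <= B -> (forall c, 1 < c -> A <= c ^+ n * B) -> A <= B.
Proof.
move=> A0; elim: n B => [|n IH] B B0 AB.
  by have := AB 2; rewrite expr0 mul1r; apply; rewrite ltr1n.
have real_gt1 (c : K) : 1 < c -> c \is Num.real.
  by move=> c1; rewrite ger0_real// ltW// (lt_trans ltr01).
have {IH AB} AcB c : 1 < c -> A <= c * B.
  move=> c1; apply: IH => [|c' c'1].
    by rewrite mulr_ge0// ltW// (lt_trans ltr01).
  have c0 : 0 <= c by rewrite ltW// (lt_trans ltr01).
  have c'0 : 0 <= c' by rewrite ltW// (lt_trans ltr01).
  have [cc'|c'c] := real_leP (real_gt1 _ c1) (real_gt1 _ c'1).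
  - apply: le_trans (AB _ c1) _; rewrite exprSr -mulrA ler_wpM2r ?mulr_ge0//.
    by rewrite lerXn2r.
  - apply: le_trans (AB _ c'1) _; rewrite exprSr -mulrA ler_wpM2l ?exprn_ge0//.
    by rewrite ler_wpM2r// ltW.
rewrite real_leNgt ?ger0_real//; apply/negP => BA.
have [BE|Bn0] := eqVneq B 0.
  have := AcB 2; rewrite ltr1n BE mulr0 => /(_ isT) /(lt_le_trans BA).
  by rewrite BE ltxx.
have Bgt0 : 0 < B by rewrite lt_neqAle eq_sym Bn0.
(* The midpoint of 1 and [A / B] would give [A <= (A + B) / 2]. *)
have /AcB : 1 < (A / B + 1) / 2.
  by rewrite ltr_pdivlMr// mul1r (natrD _ 1 1) ltrD2r ltr_pdivlMr// mul1r.
rewrite mulrAC mulrDl divfK// mul1r ler_pdivlMr// mulr_natr mulr2n lerD2l.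
by move=> AB; have := lt_le_trans BA AB; rewrite ltxx.
Qed.

Lemma prodr_const_neq (K : comNzRingType) n (c : K) (i0 : 'I_n.+1) :
  \prod_(i < n.+1 | i != i0) c = c ^+ n.
Proof. by rewrite big_const -Monoid.iteropE cardC1 card_ord. Qed.

(** * Linearity in one slot and diagonal tensors *)

Section Multilinear.
Context (K : numFieldType) (X W : lmodType K) (d : nat).
Context (f : ('I_d -> X) -> W) (mf : multilinear f).

(** Packed as a linear map, so that the general lemmas on sums, differences and multiples apply in a
    single slot. *)
Definition slot (x : 'I_d -> X) (i : 'I_d) : {linear X -> W} :=
  HB.pack (fun u => f (upd x i u))
    (GRing.isLinear.Build K X W *:%R (fun u => f (upd x i u)) (mf x i)).

Lemma slotE x i u : slot x i u = f (upd x i u).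
Proof. by []. Qed.

Lemma upd_id (x : 'I_d -> X) i : upd x i (x i) = x.
Proof. by apply/funext => j; rewrite /upd; case: eqP => [->|]. Qed.

End Multilinear.

(** The scalar is introduced slot by slot: [h k] carries it in the first [k] slots. *)
Lemma tens_scale (K : numFieldType) (X : lmodType K) d (a : K) (x : X) :
  tens (fun _ : 'I_d => a *: x) = a ^+ d *: tens (fun _ : 'I_d => x).
Proof.
pose h k (i : 'I_d) := if (i < k)%N then a *: x else x.
suff H k : (k <= d)%N -> tens (h k) = a ^+ k *: tens (fun _ : 'I_d => x).
  rewrite -H//; congr tens; apply/funext => i.
  by rewrite /h ltn_ord.
elim: k => [_|k IH kd].
  by rewrite expr0 scale1r; congr tens; apply/funext.
pose i := Ordinal kd.
have -> : h k.+1 = upd (h k) i (a *: h k i).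
  apply/funext => j; rewrite /h /upd -val_eqE/= ltnS leq_eqVlt ltnn.
  by case: eqP => //= ->.
rewrite -(slotE (@tens_multilinear K X d)) linearZ /= upd_id IH 1?ltnW//.
by rewrite scalerA -exprS.
Qed.

(** * Norms and dual norms *)

Section Norm.
Context (K : numFieldType) (V : lmodType K) (N : V -> K) (nN : is_norm N).

Lemma is_norm0 : N 0 = 0.
Proof. by have := is_normZ nN 0 0; rewrite scale0r normr0 mul0r. Qed.

Lemma is_normN w : N (- w) = N w.
Proof. by rewrite -scaleN1r (is_normZ nN) normrN1 mul1r. Qed.

Lemma is_norm_distC w z : N (w - z) = N (z - w).
Proof. by rewrite -is_normN opprB. Qed.

Lemma is_norm_dist_triangle v w z : N (w - z) <= N (w - v) + N (v - z).
Proof. by rewrite -[w - z](subrKA v); exact: is_normD. Qed.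

Lemma metric_on_norm (A : set V) : metric_on A (norm_dist N).
Proof.
rewrite /norm_dist; split=> [x y _ _|x y _ _|x y _ _|x y z _ _ _].
- exact: is_norm_ge0.
- split=> [/(is_norm_eq0 nN)/eqP|->]; first by rewrite subr_eq0 => /eqP.
  by rewrite subrr is_norm0.
- exact: is_norm_distC.
- exact: is_norm_dist_triangle.
Qed.

Lemma dual_norm_le (phi : V -> K) (c : K) : 0 <= c ->
  (forall w, N w <= 1 -> `|phi w| <= c) -> dual_norm N phi <= c.
Proof.
(* In both default cases the supremum is 0, which is at most [c]. *)
move=> c0 phic; rewrite /dual_norm /supremum; case: ifP => // _.
case: xgetP => [s -> [_ slb]|//]; apply: slb => _ [w /= Nw <-].
exact: phic.
Qed.

Lemma dual_norm_ge0 (phi : V -> K) : 0 <= dual_norm N phi.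
Proof.
rewrite /dual_norm /supremum; case: ifP => // _.
case: xgetP => [s -> [sub _]|//]; apply: le_trans (normr_ge0 (phi 0)) _.
by apply: sub; exists 0 => //=; rewrite is_norm0.
Qed.

(** Boundedness makes the supremum in [dual_norm] a true one rather than the default 0; then [w] is
    rescaled to norm one. *)
Lemma le_dual_norm (R : realType) (hK : real_or_complex R K)
    (phi : {linear V -> K^o}) (w : V) : bounded_for N phi ->
  `|phi w| <= dual_norm N phi * N w.
Proof.
move=> [M phiM].
(* [M] carries no sign, so the bound on the unit ball is stated with [|M|]. *)
have phiM' v : N v <= 1 -> `|phi v| <= `|M|.
  move=> Nv; have MN : 0 <= M * N v by exact: le_trans (phiM v).
  apply: le_trans (phiM v) _; rewrite -[M * N v]ger0_norm// normrM.
  by rewrite ler_piMr// ger0_norm// is_norm_ge0.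
have [s slub] : exists s, supremums [set `|phi w| | w in [set w | N w <= 1]] s.
  apply: (exists_supremum hK (M := `|M|)).
  - by exists `|phi 0|, 0 => //=; rewrite is_norm0.
  - by move=> _ [v _ <-].
  - by move=> _ [v Nv <-]; exact: phiM'.
have ub v : N v <= 1 -> `|phi v| <= dual_norm N phi.
  move=> Nv; rewrite /dual_norm /supremum; case: ifPn => [/eqP E|_].
    have : [set `|phi w| | w in [set w | N w <= 1]] `|phi v| by exists v.
    by rewrite E.
  by have [+ _] := @xgetI _ 0 _ s slub; apply; exists v.
have [Nw|Nw] := eqVneq (N w) 0.
  by rewrite (is_norm_eq0 nN Nw) linear0 normr0 is_norm0 mulr0.
have Nw0 : 0 < N w by rewrite lt_neqAle eq_sym Nw (is_norm_ge0 nN).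
rewrite -ler_pdivrMr//.
have <- : `|phi ((N w)^-1 *: w)| = `|phi w| / N w.
  by rewrite linearZ /= normrM normfV (gtr0_norm Nw0) mulrC.
by apply: ub; rewrite (is_normZ nN) normfV gtr0_norm// mulVf.
Qed.

End Norm.

(** * Contractions and near-Auerbach systems *)

Section CrossNorm.
Context (R : realType) (K : numFieldType) (hK : real_or_complex R K).
Context (X : normedModType K).

Definition contraction (phi : {linear X -> K^o}) := forall x, `|phi x| <= `|x|.

Lemma contraction_continuous phi : contraction phi -> continuous phi.
Proof.
move=> cphi; apply/linear_bounded_continuous/linear_boundedP.
near=> r => x; apply: le_trans (cphi x) _; rewrite ler_peMl//.
Unshelve. all: by end_near. Qed.

Lemma is_norm_normr : is_norm (fun x : X => `|x|).
Proof.
split=> [w|w /eqP|a w|w z]; [exact: normr_ge0| |exact: normrZ|exact: ler_normD].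
by rewrite normr_eq0 => /eqP.
Qed.

(* The injective norm is the smallest reasonable cross norm. *)
Lemma tfun_contraction_le d (beta : tpow X d -> K)
    (hbeta : reasonable_cross_norm beta) (phi : 'I_d -> {linear X -> K^o}) w :
  (forall i, contraction (phi i)) -> `|tfun phi w| <= beta w.
Proof.
move=> cphi.
have [bphi phi1] := rcn_dual hbeta (fun i => contraction_continuous (cphi i)).
apply: le_trans (le_dual_norm (rcn_norm hbeta) hK w bphi) _.
rewrite ler_piMl ?(is_norm_ge0 (rcn_norm hbeta))//; apply: le_trans phi1 _.
apply: prodr_ile1 => i _.
rewrite (dual_norm_ge0 is_norm_normr) dual_norm_le// => x.
exact: le_trans (cphi i x).
Qed.

Lemma tfun_tens d (phi : 'I_d -> {linear X -> K^o}) (x : 'I_d -> X) :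
  tfun phi (tens x) = \prod_i phi i (x i).
Proof. exact: tlift_tens. Qed.

(* The extremal problem of Auerbach's lemma is posed in the dual ball instead of
   the span of [x] and [y], so that Hahn-Banach extensions are not needed; a
   near-maximiser avoids weak-* compactness. *)
Lemma near_Auerbach (x y : X) (c : K) : 1 < c ->
  exists (phi : bool -> {linear X -> K^o}) (e : bool -> X),
    [/\ forall b, contraction (phi b), forall b, `|e b| <= c,
        \sum_b phi b x *: e b = x & \sum_b phi b y *: e b = y].
Proof.
move=> c1; have c0 : 0 < c by exact: lt_trans c1.
pose det (phi psi : {linear X -> K^o}) : K := phi x * psi y - psi x * phi y.
have formB (f : {linear X -> K^o}) (a b : K) (v w : X) :
    f (a *: v - b *: w) = a * f v - b * f w by rewrite linearB !linearZ.
have [[phi [psi [cphi cpsi det0]]]|det0] := pselect (exists phi psi,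
    [/\ contraction phi, contraction psi & det phi psi != 0]); last first.
  (* When all determinants vanish, [x] and [y] lie on one line, spanned by [v]. *)
  suff [v [vx vy]] : exists v : X,
      (exists s, x = s *: v) /\ (exists t, y = t *: v).
    have [phi [cphi phiv]] := norming_functional hK v.
    have [v0|v0] := eqVneq v 0.
      exists (fun=> phi), (fun=> 0); split=> //.
      - by move=> _; rewrite normr0 ltW.
      - by case: vx => s ->; rewrite v0 big1 => [|b _]; rewrite scaler0.
      - by case: vy => s ->; rewrite v0 big1 => [|b _]; rewrite scaler0.
    have phiv0 : phi v != 0.
      by rewrite -normr_gt0; apply: lt_le_trans phiv; rewrite normr_gt0.
    (* Both indices carry the same functional, so one of the two vectors must be 0. *)
    pose e b := if b then (phi v)^-1 *: v else 0.
    have combv s : \sum_b phi (s *: v) *: e b = s *: v.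
      by rewrite big_bool/= scaler0 addr0 [phi _]linearZ scalerA mulfK.
    exists (fun=> phi), e; split=> //.
    - case; rewrite /e; last by rewrite normr0 ltW.
      rewrite normrZ normfV ler_pdivrMl ?normr_gt0// (le_trans phiv)//.
      by rewrite ler_peMr// ltW.
    - by case: vx => s ->.
    - by case: vy => s ->.
  have [->|x0] := eqVneq x 0.
    by exists y; split; [exists 0; rewrite scale0r|exists 1; rewrite scale1r].
  exists x; split; first by exists 1; rewrite scale1r.
  have [phi [cphi phix]] := norming_functional hK x.
  have phix0 : phi x != 0.
    by rewrite -normr_gt0; apply: lt_le_trans phix; rewrite normr_gt0.
  (* The value of [psi] at this vector is [det phi psi], which vanishes, and [psi] norms the
     vector. *)
  have [psi [cpsi psiz]] := norming_functional hK (phi x *: y - phi y *: x).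
  exists (phi y / phi x); apply: (scalerI phix0).
  rewrite scalerA mulrCA divff// mulr1.
  apply/eqP; rewrite -subr_eq0 -normr_le0; apply: le_trans psiz _.
  rewrite normr_le0; apply: contra_notT det0 => det1.
  exists phi, psi; split=> //; move: det1.
  by rewrite formB /det [psi x * _]mulrC.
have [s [sub slb]] : exists s, supremums [set r | exists phi psi,
    [/\ contraction phi, contraction psi & r = `|det phi psi|]] s.
  apply: (exists_supremum hK (M := `|x| * `|y| + `|x| * `|y|)).
  - by exists `|det phi psi|, phi, psi.
  - by move=> _ [? [? [_ _ ->]]].
  - move=> _ [f [g [cf cg ->]]]; apply: le_trans (ler_normB _ _) _.
    by rewrite !normrM lerD// ler_pM.
have s0 : 0 < s.
  apply: lt_le_trans (sub _ _); last by exists phi, psi; split.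
  by rewrite normr_gt0.
have {phi psi cphi cpsi det0} [phi [psi [cphi cpsi sdet]]] : exists phi psi,
    [/\ contraction phi, contraction psi & s <= c * `|det phi psi|].
  (* Otherwise [s / c], which is smaller than [s], would be an upper bound. *)
  apply: contrapT => nex.
  suff /slb : ubound [set r | exists phi psi,
      [/\ contraction phi, contraction psi & r = `|det phi psi|]] (s / c).
    by rewrite ler_pdivlMr// ger_pMr// => /(lt_le_trans c1); rewrite ltxx.
  move=> _ [f [g [cf cg ->]]]; rewrite ler_pdivlMr// mulrC.
  rewrite real_leNgt ?ger0_real ?mulr_ge0 ?(ltW c0) ?(ltW s0)//.
  by apply/negP => /ltW sfg; apply: nex; exists f, g.
have det0 : det phi psi != 0.
  apply: contraTneq sdet => ->; rewrite normr0 mulr0.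
  by rewrite real_leNgt ?real0 ?gtr0_real// s0.
(* Cramer's rule: [u], [v] is the pair in the span of [x], [y] dual to [phi], [psi]. *)
pose u := (det phi psi)^-1 *: (psi y *: x - psi x *: y).
pose v := (det phi psi)^-1 *: (phi x *: y - phi y *: x).
exists (fun b => if b then phi else psi), (fun b => if b then u else v).
(* A contraction evaluated at the numerator is a determinant with one functional replaced, hence at
   most [s] in absolute value. *)
have bound w : (forall f, contraction f -> exists g h,
    [/\ contraction g, contraction h & `|f w| = `|det g h|]) ->
    `|(det phi psi)^-1 *: w| <= c.
  move=> wdet; have [f [cf fw]] := norming_functional hK w.
  rewrite normrZ normfV ler_pdivrMl ?normr_gt0// mulrC; apply: le_trans fw _.
  apply: le_trans sdet; apply: sub.
  by have [g [h [cg ch ->]]] := wdet _ cf; exists g, h.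
have combE a b p q r t : a *: ((det phi psi)^-1 *: (p *: x - q *: y)) +
    b *: ((det phi psi)^-1 *: (r *: y - t *: x)) =
    ((det phi psi)^-1 * (a * p - b * t)) *: x +
    ((det phi psi)^-1 * (b * r - a * q)) *: y.
  rewrite !mulrBr !scalerBl !scalerBr !scalerA -!mulrA !(mulrCA _ _^-1).
  by rewrite [X in _ + X = _]addrC addrACA [X in _ + X = _]addrC.
split.
- by case.
- case; apply: bound => f cf.
  + by exists f, psi; split=> //; rewrite formB /det [f x * _]mulrC.
  + by exists phi, f; split=> //; rewrite formB /det [f x * _]mulrC.
- rewrite big_bool/= combE [psi x * phi x]mulrC subrr mulr0 scale0r addr0.
  by rewrite mulVf// scale1r.
- rewrite big_bool/= combE [psi y * phi y]mulrC subrr mulr0 scale0r add0r.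
  by rewrite [psi y * _]mulrC [phi y * _]mulrC mulVf// scale1r.
Qed.

(** * Expansion of diagonal tensors and comparison of cross norms *)

Section Expansion.
Context (n : nat) (phi : bool -> {linear X -> K^o}) (e : bool -> X).
(** Coefficient of the term chosen by [h] once the first [k] slots are expanded; [h] is read below
    [k] only. *)
Definition expand_coef (h : 'I_n.+1 -> bool) (k : nat) (x : X) : K :=
  \prod_(i < n.+1 | (i < k)%N) phi (h i) x.

Definition expand_vec (h : 'I_n.+1 -> bool) (k : nat) (x : X) : 'I_n.+1 -> X :=
  fun i => if (i < k)%N then e (h i) else x.

Lemma expandS (h : 'I_n.+1 -> bool) (k : 'I_n.+1) x :
  \sum_b phi b x *: e b = x ->
  expand_coef h k x *: tens (expand_vec h k x) =
  \sum_b expand_coef (upd h k b) k.+1 x *: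
    tens (expand_vec (upd h k b) k.+1 x).
Proof.
move=> xE.
have -> : expand_vec h k x = upd (expand_vec h k x) k x.
  apply/funext => j; rewrite /upd; case: eqP => // ->.
  by rewrite /expand_vec ltnn.
rewrite -(slotE (@tens_multilinear K X n.+1)) -[X in slot _ _ _ X]xE.
rewrite linear_sum scaler_sumr.
apply: eq_bigr => b _; rewrite linearZ/= scalerA; congr (_ *: tens _).
- rewrite /expand_coef [RHS](bigD1 k)//= /upd eqxx mulrC; congr (_ * _).
  apply: eq_big => [i|i ik]; first by rewrite ltnS ltn_neqAle andbC -val_eqE.
  by case: eqP => // ki; rewrite ki ltnn in ik.
- apply/funext => j; rewrite /expand_vec /upd -val_eqE ltnS.
  rewrite [(j <= k)%N]leq_eqVlt.
  by case: eqP.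
Qed.

End Expansion.

Lemma tens_diag_dist_le n (alpha beta : tpow X n.+1 -> K)
    (halpha : reasonable_cross_norm alpha)
    (hbeta : reasonable_cross_norm beta) (x y : X) :
  alpha (tens (fun=> x) - tens (fun=> y)) <=
  2 ^+ n * beta (tens (fun=> x) - tens (fun=> y)).
Proof.
have nA := rcn_norm halpha; have nB := rcn_norm hbeta.
apply: (@le_of_forall_gt1_expr _ _ _ n) => [||c c1].
- exact: is_norm_ge0.
- by rewrite mulr_ge0 ?exprn_ge0// is_norm_ge0.
have [phi [e [cphi ec xE yE]]] := near_Auerbach x y c1.
have c0 : 0 <= c by rewrite ltW// (lt_trans ltr01).
set w := tens (fun=> x) - tens (fun=> y).
(* The terms of [x] and [y] with the same choice [h] are paired. *)
pose D (h : 'I_n.+1 -> bool) k :=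
  expand_coef phi h k x *: tens (expand_vec e h k x) -
  expand_coef phi h k y *: tens (expand_vec e h k y).
have Dn h : alpha (D h n) <= c ^+ n * beta w.
  (* After [n] expansions the paired tensors differ in the last slot only, so they merge into one
     elementary tensor with [v] there. *)
  pose v := expand_coef phi h n x *: x - expand_coef phi h n y *: y.
  have vecE z : expand_vec e h n z = upd (e \o h) ord_max z.
    apply/funext => j; rewrite /expand_vec /upd -val_eqE/= ltn_neqAle -ltnS.
    by rewrite ltn_ord andbT; case: eqP.
  have -> : D h n = tens (upd (e \o h) ord_max v).
    rewrite /D !vecE -!(slotE (@tens_multilinear K X n.+1)).
    by rewrite linearB !linearZ.
  apply: le_trans (rcn_tens halpha _) _.
  rewrite (bigD1 ord_max)//= {1}/upd eqxx mulrC; apply: ler_pM => //.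
  + by rewrite prodr_ge0.
  + rewrite -(prodr_const_neq _ ord_max).
    by apply: ler_prod => i /negPf im; rewrite normr_ge0 /upd im ec.
  have [psi [cpsi vpsi]] := norming_functional hK v.
  apply: le_trans vpsi _.
  (* The functionals chosen by [h] reproduce the two coefficients, and [psi] in the last slot gives
     [psi v]. *)
  pose f := upd (phi \o h) ord_max psi.
  have fE z : tfun f (tens (fun=> z)) = expand_coef phi h n z * psi z.
    rewrite tfun_tens (bigD1 ord_max)//= {1}/f {1}/upd eqxx mulrC.
    congr (_ * _).
    apply: eq_big => [i|i /negPf im]; last by rewrite /f /upd im.
    by rewrite -val_eqE/= ltn_neqAle -ltnS ltn_ord andbT.
  have -> : psi v = tfun f w.
    by rewrite /v /w [tfun f _]linearB !fE linearB !linearZ.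
  apply: (tfun_contraction_le hbeta) => i; rewrite /f /upd.
  by case: eqP => // _; exact: cphi.
(* Each of the [m] slots still to be expanded doubles the number of terms. *)
have Dk m : forall k h, (k + m = n)%N ->
    alpha (D h k) <= 2 ^+ m * (c ^+ n * beta w).
  elim: m => [k h|m IH k h kmn].
    by rewrite addn0 => ->; rewrite mul1r Dn.
  have kn : (k < n.+1)%N by rewrite -kmn ltnS leq_addr.
  have -> : D h k = D (upd h (Ordinal kn) true) k.+1 +
      D (upd h (Ordinal kn) false) k.+1.
    rewrite /D (@expandS n phi e h (Ordinal kn) x xE).
    rewrite (@expandS n phi e h (Ordinal kn) y yE) !big_bool/=.
    by rewrite opprD addrACA.
  apply: le_trans (is_normD nA _ _) _.
  rewrite exprS mulr2n 2!mulrDl !mul1r.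
  by apply: lerD; apply: IH; rewrite addSnnS.
have := Dk n 0%N (fun=> true) (add0n _).
rewrite mulrCA /D /expand_coef !big_pred0// !scale1r.
have E z : expand_vec e (fun=> true) 0 z = (fun _ : 'I_n.+1 => z) by [].
by rewrite !E.
Qed.

(* Replace the entries of the tensor one at a time. *)
Lemma tens_diag_lipschitz n (alpha : tpow X n.+1 -> K)
    (halpha : reasonable_cross_norm alpha) (x y : X) (M : K) :
  `|x| <= M -> `|y| <= M ->
  alpha (tens (fun=> x) - tens (fun=> y)) <= n.+1%:R * (M ^+ n * `|x - y|).
Proof.
move=> xM yM; have nA := rcn_norm halpha.
have M0 : 0 <= M by exact: le_trans xM.
pose h k (i : 'I_n.+1) := if (i < k)%N then x else y.
suff H k : (k <= n.+1)%N ->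
    alpha (tens (h k) - tens (fun=> y)) <= k%:R * (M ^+ n * `|x - y|).
  have <- : h n.+1 = (fun=> x) by apply/funext => i; rewrite /h ltn_ord.
  exact: H.
elim: k => [_|k IH kn].
  have -> : h 0 = (fun=> y) by [].
  by rewrite subrr is_norm0// mul0r.
apply: le_trans (is_norm_dist_triangle nA (tens (h k)) _ _) _.
rewrite -[k.+1]add1n natrD mulrDl mul1r; apply: lerD; last by rewrite IH// ltnW.
pose i := Ordinal kn.
have -> : h k.+1 = upd (h k) i x.
  apply/funext => j; rewrite /h /upd -val_eqE/= ltnS leq_eqVlt.
  by case: eqP.
have -> : tens (h k) = tens (upd (h k) i y).
  congr tens; apply/funext => j; rewrite /h /upd; case: eqP => // ->.
  by rewrite ltnn.
rewrite -!(slotE (@tens_multilinear K X n.+1)) -linearB slotE.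
apply: le_trans (rcn_tens halpha _) _.
rewrite (bigD1 i)//= {1}/upd eqxx mulrC ler_wpM2r//.
rewrite -(prodr_const_neq _ i); apply: ler_prod => j /negPf ji.
rewrite normr_ge0 /upd ji /h.
by case: ifP.
Qed.

End CrossNorm.

(** * Cauchy sequences of diagonal tensors *)

Lemma cvgX (K : numFieldType) (T : Type) (F : set_system T) {FF : Filter F}
    (f : T -> K) (a : K) n :
  f @ F --> a -> (fun x => f x ^+ n) @ F --> a ^+ n.
Proof.
move=> fa; elim: n => [|n IH]; first exact: cvg_cst.
by under eq_fun do rewrite exprS; rewrite exprS; exact: cvgM.
Qed.

Lemma cauchy_seq_cvg (K : numFieldType) (X : completeNormedModType K)
    (z : nat -> X) :
  cauchy_seq (fun x y => `|x - y|) z -> cvg (z @ \oo).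
Proof.
move=> cz; apply/cauchy_cvgP/cauchyP => e e0.
have [N zN] := cz e e0; exists (z N); exists N => // n /= Nn.
by rewrite -ball_normE; apply: zN.
Qed.

Section Complete.
Context (R : realType) (K : numFieldType) (hK : real_or_complex R K).
Context (X : completeNormedModType K).

Lemma cauchy_tens_diag_cvg n (alpha : tpow X n.+1 -> K)
    (halpha : reasonable_cross_norm alpha) (x : nat -> X) :
  cauchy_seq (norm_dist alpha) (fun m => tens (fun=> x m)) ->
  exists y : X, cvg_seq (norm_dist alpha) (fun m => tens (fun=> x m))
    (tens (fun=> y)).
Proof.
rewrite /norm_dist => ucauchy; have nA := rcn_norm halpha.
set u : nat -> tpow X n.+1 := fun m => tens (fun=> x m).
(* If there is no such [e], the sequence tends to 0, the diagonal tensor of the zero vector. *)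
have [[e [e0 ue]]|u0] := pselect (exists e : K, 0 < e /\
    forall N, exists m, (N <= m)%N /\ e <= alpha (u m)); last first.
  exists 0 => e e0; apply: contrapT => ue; apply: u0; exists e; split=> // N.
  apply: contrapT => Nm; apply: ue; exists N => m Nlem.
  have -> : tens (fun=> 0) = 0 :> tpow X n.+1.
    by rewrite -(scale0r (0 : X)) tens_scale expr0n scale0r.
  rewrite subr0 real_ltNge ?ger0_real ?(ltW e0) ?is_norm_ge0//.
  by apply/negP => eu; apply: Nm; exists m.
have e20 : 0 < e / 2 by rewrite divr_gt0.
have [N0 uN0] := ucauchy _ e20.
have [N [N0N eN]] := ue N0.
have {}uN m : (N <= m)%N -> alpha (u m - u N) < e / 2.
  by move=> Nm; apply: uN0 => //; exact: leq_trans Nm.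
have [phi [cphi phiN]] := norming_functional hK (x N).
(* Applying [phi] in [n] slots of [u m] leaves [z m]. *)
pose z m := phi (x m) ^+ n *: x m.
have phiz m : phi (z m) = phi (x m) ^+ n.+1 by rewrite linearZ exprSr.
have tens_z m : tens (fun=> z m) = phi (z m) ^+ n *: u m.
  by rewrite tens_scale phiz -!exprM mulnC.
have phi_dist m k : `|phi (z m) - phi (z k)| <= alpha (u m - u k).
  apply: le_trans _ (tfun_contraction_le hK halpha (phi := fun=> phi) _ _);
    last by [].
  by rewrite linearB !tfun_tens !prodr_const card_ord !phiz.
have z_dist m k : `|z m - z k| <= alpha (u m - u k).
  have [psi [cpsi psiz]] := norming_functional hK (z m - z k).
  apply: le_trans psiz _.
  pose f := upd (fun _ : 'I_n.+1 => phi) ord0 psi.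
  have fE v : tfun f (tens (fun=> v)) = phi v ^+ n * psi v.
    rewrite tfun_tens (bigD1 ord0)//= {1}/f {1}/upd eqxx mulrC; congr (_ * _).
    rewrite -(prodr_const_neq _ ord0).
    by apply: eq_bigr => i /negPf i0; rewrite /f /upd i0.
  have -> : psi (z m - z k) = tfun f (u m - u k).
    by rewrite [RHS]linearB !fE linearB !linearZ.
  apply: (tfun_contraction_le hK halpha) => i.
  by rewrite /f /upd; case: ifP.
have /cauchy_seq_cvg zcvg : cauchy_seq (fun x y => `|x - y|) z.
  move=> r /ucauchy[M uM]; exists M => m k Mm Mk.
  exact: le_lt_trans (z_dist m k) (uM _ _ Mm Mk).
pose z0 := lim (z @ \oo); pose a := phi z0.
have zz0 : z @ \oo --> z0 by [].
have phiza : (fun m => phi (z m) : K) @ \oo --> (a : K).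
  by apply: continuous_cvg => //; exact: contraction_continuous.
have phizN : e <= `|phi (z N)|.
  apply: le_trans eN _; apply: le_trans (rcn_tens halpha _) _.
  rewrite prodr_const card_ord phiz normrX.
  by rewrite lerXn2r// ?nnegrE.
(* The two errors of [e / 2] stay below [e], hence below [|phi (z N)|]; this makes [a / phi (z N)]
   close to 1. *)
have phizN_near : `|a - phi (z N)| < e.
  near \oo => m; rewrite -[a - _](subrKA (phi (z m))).
  apply: le_lt_trans (ler_normD _ _) _; rewrite [e]splitr; apply: ltrD.
  - by near: m; move/cvgrPdist_lt : phiza; exact.
  - apply: le_lt_trans (phi_dist _ _) _; apply: uN.
    by near: m; exact: nbhs_infty_ge.
have phizN0 : phi (z N) != 0.
  by rewrite -normr_gt0 (lt_le_trans e0).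
have a_near : `|a / phi (z N) - 1| < 1.
  rewrite -{1}(divff phizN0) -mulrBl normrM normfV.
  rewrite ltr_pdivrMr ?normr_gt0// mul1r.
  exact: lt_le_trans phizN_near _.
have a0 : a != 0.
  by apply: contraTneq a_near => ->; rewrite mul0r sub0r normrN1 ltxx.
have [r rE] := exists_root_near1 hK n a_near.
pose t := r * phi (x N).
have tE : t ^+ n.+1 = a by rewrite exprMn rE -phiz divfK.
(* By [tens_z] the limit should be [a ^- n *: tens (fun=> z0)], and [a ^- n] is the [n.+1]-th power
   of [t ^- n]. *)
exists (t ^- n *: z0).
have -> : tens (fun=> t ^- n *: z0) = a ^- n *: tens (fun=> z0) :> tpow X n.+1.
  by rewrite tens_scale exprVn -exprM mulnC exprM tE.
pose C := alpha (u N) + e / 2.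
have uC m : (N <= m)%N -> alpha (u m) <= C.
  move=> Nm; rewrite -[u m](subrK (u N)) addrC.
  by apply: le_trans (is_normD nA _ _) _; rewrite lerD2l ltW// uN.
pose M := `|z0| + 1.
(* The first summand is the error in the scalar, the second the error in the vector. *)
pose g m := `|a ^+ n - phi (z m) ^+ n| * C + n.+1%:R * (M ^+ n * `|z m - z0|).
have g0 : g @ \oo --> (0 : K).
  have -> : 0 = `|a ^+ n - a ^+ n| * C + n.+1%:R * (M ^+ n * `|z0 - z0|) :> K.
    by rewrite !subrr !normr0 mul0r !mulr0 addr0.
  apply: cvgD; apply: cvgM.
  - apply: cvg_norm; apply: cvgB; [exact: cvg_cst|exact: cvgX].
  - exact: cvg_cst.
  - exact: cvg_cst.
  - apply: cvgM; first exact: cvg_cst.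
    by apply: cvg_norm; apply: cvgB => //; exact: cvg_cst.
have ug m : (N <= m)%N -> `|z m| <= M ->
    alpha (u m - a ^- n *: tens (fun=> z0)) <= `|a| ^- n * g m.
  move=> Nm zM; rewrite -normrX -normfV.
  have -> : u m - a ^- n *: tens (fun=> z0) =
      a ^- n *: ((a ^+ n - phi (z m) ^+ n) *: u m +
                 (tens (fun=> z m) - tens (fun=> z0))).
    rewrite tens_z addrA scalerBl subrK scalerBr scalerA mulVf ?scale1r//.
    by rewrite expf_neq0.
  rewrite (is_normZ nA) ler_wpM2l//; apply: le_trans (is_normD nA _ _) _.
  apply: lerD; first by rewrite (is_normZ nA) ler_wpM2l// uC.
  by apply: tens_diag_lipschitz => //; rewrite lerDl.
move=> eps eps0.
suff [N' _ H] : \forall m \near \oo,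
    alpha (u m - a ^- n *: tens (fun=> z0)) < eps by exists N'.
have an0 : 0 < `|a| ^+ n by rewrite exprn_gt0 ?normr_gt0.
near=> m; apply: le_lt_trans (ug m _ _) _.
- by near: m; exact: nbhs_infty_ge.
- near: m; apply: cvgr_norm_le zz0 _ _; rewrite ltrDl ltr01//.
- rewrite ltr_pdivrMl//; apply: le_lt_trans (real_ler_norm _) _.
    have C0 : 0 <= C by rewrite addr_ge0 ?(is_norm_ge0 nA) ?(ltW e20).
    have M0 : 0 <= M by rewrite addr_ge0.
    by rewrite ger0_real// addr_ge0 ?mulr_ge0 ?exprn_ge0.
  rewrite -[g m]opprK normrN -sub0r.
  by near: m; move/cvgrPdist_lt : g0; apply; rewrite mulr_gt0.
Unshelve. all: by end_near. Qed.

End Complete.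

(** * Conclusions for the Veronese set in every degree *)

(** There is only one function on the empty index set. *)
Lemma veronese0_eq (K : numFieldType) (X : lmodType K) (w z : tpow X 0) :
  veronese X 0 w -> veronese X 0 z -> w = z.
Proof.
by move=> [x ->] [y ->]; congr tens; apply/funext => -[].
Qed.

Lemma veronese_dist_le (R : realType) (K : numFieldType)
    (hK : real_or_complex R K) (X : normedModType K) (d : nat)
    (alpha beta : tpow X d -> K)
    (halpha : reasonable_cross_norm alpha)
    (hbeta : reasonable_cross_norm beta) (w z : tpow X d) :
  veronese X d w -> veronese X d z ->
  norm_dist alpha w z <= 2%:R ^+ d.-1 * norm_dist beta w z.
Proof.
case: d alpha beta halpha hbeta w z => [|n] alpha beta halpha hbeta w z.
  (* In degree 0 both distances vanish. *)
  move=> /veronese0_eq wz /wz ->; rewrite /norm_dist subrr.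
  by rewrite (is_norm0 (rcn_norm halpha)) (is_norm0 (rcn_norm hbeta)) mulr0.
by move=> [x ->] [y ->]; exact: (tens_diag_dist_le hK halpha hbeta x y).
Qed.

Lemma complete_veronese (R : realType) (K : numFieldType)
    (hK : real_or_complex R K) (X : completeNormedModType K) (d : nat)
    (alpha : tpow X d -> K) (halpha : reasonable_cross_norm alpha) :
  complete_metric (veronese X d) (norm_dist alpha).
Proof.
have nA := rcn_norm halpha.
split; first exact: metric_on_norm.
move=> u Vu cu; case: d alpha halpha nA u Vu cu => [|n] alpha halpha nA u Vu cu.
  exists (u 0) => // e e0; exists 0 => m _.
  by rewrite /norm_dist (veronese0_eq (Vu m) (Vu 0)) subrr is_norm0.
have [x ux] := choice Vu.
have uE : u = fun m => tens (fun=> x m) by apply/funext.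
rewrite uE in cu *; have [y yP] := cauchy_tens_diag_cvg hK halpha cu.
by exists (tens (fun=> y)) => //; exists y.
Qed.

Theorem theorem2p2 (R : realType) (K : numFieldType)
    (hK : real_or_complex R K) (X : completeNormedModType K) (d : nat)
    (alpha beta : tpow X d -> K)
    (halpha : reasonable_cross_norm alpha)
    (hbeta : reasonable_cross_norm beta) :
  (bi_lipschitz (veronese X d) (veronese X d)
      (norm_dist alpha) (norm_dist beta) idfun /\
   (forall w z : tpow X d, veronese X d w -> veronese X d z ->
      norm_dist alpha w z <= 2%:R ^+ d.-1 * norm_dist beta w z)) /\
  complete_metric (veronese X d) (norm_dist alpha).
Proof.
split; last exact: (complete_veronese hK).
split; last by move=> w z; exact: (veronese_dist_le hK).
split.
- exact: metric_on_norm (rcn_norm halpha) _.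
- exact: metric_on_norm (rcn_norm hbeta) _.
- by split=> [w Vw|w z _ _|w Vw]; [|exact|exists w].
(* The bound is symmetric in the two norms, so one constant serves both directions. *)
- exists (2%:R ^+ d.-1), (2%:R ^+ d.-1); split; rewrite ?exprn_gt0//.
  by move=> w z Vw Vz; split; exact: (veronese_dist_le hK).
Qed.
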